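(* Let $K:(0,\infty)^2\to[0,\infty)$ be measurable and symmetric. (i) If $K(x,y)\le (x+y)\log(e+x\wedge y)$ for all $x,y>0$, then any weak solution $(f_t)_{t\ge0}$ to the Smoluchowski coagulation equation with kernel $K$ such that $M_1(f_0)+M_2(f_0)<\infty$ is non-gelling. (ii) If there is some $\alpha>1$ such that $K(x,y)\ge (x+y)\log^\alpha(e+x\wedge y)$ for all $x,y>0$, then any weak solution $(f_t)_{t\ge0}$ to the Smoluchowski coagulation equation with kernel $K$ such that $M_1(f_0)\in(0,\infty)$ and $\int_0^1 x|\log x|\,\mathbf{1}_{\{x<1\}}\,f_0(\mathrm{d}x)<\infty$ is gelling.
   Context: Notation: $x\wedge y=\min\{x,y\}$, $\log^\alpha(z)=(\log z)^\alpha$. For a nonnegative measure $f$ on $(0,\infty)$ and $k\in\mathbb{R}$, $M_k(f)=\int_0^\infty x^k f(\mathrm{d}x)$. Weak solution: let $K:(0,\infty)^2\to[0,\infty)$ be measurable and symmetric ($K(x,y)=K(y,x)$). A measurable family $(f_t)_{t\ge0}$ of nonnegative measures on $(0,\infty)$ is a weak solution to the Smoluchowski coagulation equation with kernel $K$ if for all $t\ge0$, $$\int_0^t\int_0^\infty\int_0^\infty K(x,y)\,f_s(\mathrm{d}y)f_s(\mathrm{d}x)\,\mathrm{d}s<\infty,$$ and for all bounded measurable $\psi:(0,\infty)\to[0,\infty)$ and all $t\ge0$, $$\int_0^\infty\psi(x)f_t(\mathrm{d}x)=\int_0^\infty\psi(x)f_0(\mathrm{d}x)+\frac12\int_0^t\int_0^\infty\int_0^\infty\Delta_\psi(x,y)K(x,y)\,f_s(\mathrm{d}y)f_s(\mathrm{d}x)\,\mathrm{d}s,$$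 where $\Delta_\psi(x,y)=\psi(x+y)-\psi(x)-\psi(y)$. The first two terms of this identity take values in $[0,\infty)\cup\{+\infty\}$, and the last one is finite. Gelling: a weak solution $(f_t)_{t\ge0}$ with $M_1(f_0)<\infty$ is gelling if it loses mass in finite time, i.e. $T_{gel}:=\inf\{t\ge0: M_1(f_t)<M_1(f_0)\}<\infty$ (with $\inf\emptyset=+\infty$); it is non-gelling if $M_1(f_t)=M_1(f_0)$ for all $t\ge0$. *)

(* Defs.v *)
From HB Require Import structures.
From mathcomp Require Import all_boot all_order all_algebra.
From mathcomp Require Import all_classical all_reals all_analysis.
From mathcomp Require Import measurable_realfun.

Set Implicit Arguments.
Unset Strict Implicit.
Unset Printing Implicit Defensive.

Import Order.TTheory GRing.Theory Num.Theory.
Import numFieldNormedType.Exports.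

Local Open Scope classical_set_scope.
Local Open Scope ring_scope.

Definition pos_half_line (R : realType) : set (measurableTypeR R) :=
  `]0, +oo[%classic.
Arguments pos_half_line : clear implicits.

(* The values of K outside (0,oo)^2 are irrelevant. *)
Definition coagulation_kernel (R : realType) (K : R -> R -> R) : Prop :=
  [/\ measurable_fun (pos_half_line R `*` pos_half_line R)
        (fun z : measurableTypeR R * measurableTypeR R => K z.1 z.2),
      forall x y : R, 0 < x -> 0 < y -> 0 <= K x y
    & forall x y : R, 0 < x -> 0 < y -> K x y = K y x].

(* Measures on (0,oo) are encoded as the Borel measures on R which do not charge
   ]-oo, 0]; they need not be finite nor sigma-finite. The values of f at
   negative times are irrelevant. *)
Definition measurable_family (R : realType)
    (f : R -> {measure set (measurableTypeR R) -> \bar R}) : Prop :=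
  (forall t : R, 0 <= t -> f t (~` pos_half_line R) = 0%E) /\
  (forall A : set (measurableTypeR R), measurable A ->
     measurable_fun (`[0, +oo[%classic : set (measurableTypeR R)) (f ^~ A)).

Definition moment (R : realType) (k : R)
    (mu : {measure set (measurableTypeR R) -> \bar R}) : \bar R :=
  (\int[mu]_(x in pos_half_line R) (x `^ k)%R%:E)%E.

Definition Delta (R : realType) (psi : R -> R) (x y : R) : R :=
  psi (x + y) - psi x - psi y.

(* Sums are taken in \bar R: the equation reads +oo = +oo + (finite) when psi is
   not integrable with respect to f 0. *)
Definition weak_solution (R : realType) (K : R -> R -> R)
    (f : R -> {measure set (measurableTypeR R) -> \bar R}) : Prop :=
  [/\ measurable_family f,
      forall t : R, 0 <= t ->
        (\int[@lebesgue_measure R]_(s in `[0%R, t])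
           \int[f s]_(x in pos_half_line R)
             \int[f s]_(y in pos_half_line R) (K x y)%:E < +oo)%E
    & forall psi : R -> R,
        measurable_fun (pos_half_line R) psi ->
        (forall x : R, 0 < x -> 0 <= psi x) ->
        (exists C : R, forall x : R, 0 < x -> psi x <= C) ->
        forall t : R, 0 <= t ->
        (\int[f t]_(x in pos_half_line R) (psi x)%:E =
         \int[f 0%R]_(x in pos_half_line R) (psi x)%:E +
         (2^-1)%R%:E *
         \int[@lebesgue_measure R]_(s in `[0%R, t])
           \int[f s]_(x in pos_half_line R)
             \int[f s]_(y in pos_half_line R) (Delta psi x y * K x y)%R%:E)%E].

Definition gelation_time (R : realType)
    (f : R -> {measure set (measurableTypeR R) -> \bar R}) : \bar R :=
  ereal_inf [set t%:E | t in
    [set t : R | 0 <= t /\ (moment 1%R (f t) < moment 1%R (f 0%R))%E]].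

Definition gelling (R : realType)
    (f : R -> {measure set (measurableTypeR R) -> \bar R}) : Prop :=
  (gelation_time f < +oo)%E.

Definition non_gelling (R : realType)
    (f : R -> {measure set (measurableTypeR R) -> \bar R}) : Prop :=
  forall t : R, 0 <= t -> moment 1 (f t) = moment 1 (f 0%R).

(* Main.v *)
Require Import Defs.
From HB Require Import structures.
From mathcomp Require Import all_boot all_order all_algebra.
From mathcomp Require Import all_classical all_reals all_analysis.
From mathcomp Require Import measurable_realfun.
From mathcomp Require Import ring lra.

Import Order.TTheory GRing.Theory Num.Theory.
Import numFieldNormedType.Exports.

Local Open Scope classical_set_scope.
Local Open Scope ring_scope.

(** Everything rests on testing the equation against well chosen [psi] and
    estimating [Delta psi * K] pointwise by functions of the form
    [a x * b y + b x * a y], whose double integrals are products of moments.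

    Non-gelling.  Since [Delta (x ^ 2) = 2 x y] and
    [K <= (x + y) log (e + min x y)], the second moment [u] satisfies
    [u' <= 2 u * \int y log (e + y) f]; bounding the logarithm by the tangent
    line [log (e + y) <= c + y exp (- c)] gives
    [u' <= 2 (c m u + exp (- c) u ^ 2)] for every [c >= 1], where [m] bounds the
    mass.  With the time-dependent choice [c = exp (4 m s)], the double
    exponential [m exp (exp (4 m s))] is a supersolution, so [u] stays finite for
    all times ([second_moment_le]).  As [x ^ 2] is not an admissible test function,
    this is done for [x ^ 2] cut off at [n], with bounds uniform in [n].  Testing
    finally against [min x N], the loss is at most a constant times [1 / N]
    because a coalescence which affects [min x N] involves a particle larger
    than [N / 2] ([trunc_mass_loss]); letting [N] grow, no mass is lost.

    Gelling.  There is a function [entropy] with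
    [Delta entropy x y <= - min x y / log ^ alpha (e + min x y)].  It has the form
    [x * weight x], where [weight] decreases by at least
    [1 / log ^ alpha (e + y)] between [y] and [2 y]: near zero this forces a
    logarithm, hence the hypothesis on [x |log x|], whereas at infinity a
    multiple of [log ^ (1 - alpha)] does, which decreases because [alpha > 1].
    The lower bound on [K] then yields [- Delta entropy * K >= x y]
    ([entropy_production]): the entropy decreases at a rate at least half the
    square of the mass.  If [C] is the initial entropy, the time integral of the
    squared mass is at most [2 C], and the mass must drop below its initial value.

    The integral of a nonnegative function is a supremum over simple functions,
    hence monotone for arbitrary functions.  The iterated and time integrals can
    therefore be estimated pointwise, provided that the bounds are separated in
    [x] and [y], and constant or explicit and continuous in time.  In the gelling
    part such a bound is available because the mass below level [N] is a
    nonincreasing function of time: on [[0, t]] it is at least its value at [t]. *)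

(** * Comparison of integrals of arbitrary functions *)

Section integral_without_measurability.
Local Open Scope ereal_scope.
Context {d} {T : measurableType d} {R : realType}.
Variables (mu : {measure set T -> \bar R}) (D : set T).

(** The integral of a nonnegative function is a supremum over the simple
    functions below it, so it is monotone without measurability: this allows
    comparisons under the iterated and time integrals of a weak solution. *)
Lemma ge0_le_lower_integral (f g : T -> \bar R) :
  (forall x, D x -> 0 <= f x) -> (forall x, D x -> f x <= g x) ->
  \int[mu]_(x in D) f x <= \int[mu]_(x in D) g x.
Proof.
move=> f0 fg.
have g0 x : D x -> 0 <= g x by move=> Dx; exact: le_trans (f0 x Dx) (fg x Dx).
rewrite !ge0_integralE//.
apply: le_ereal_sup => _ [h /= hf <-]; exists h => // x.
exact: le_trans (hf x) (lee_restrict fg x).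
Qed.

(** A signed [f] may be replaced by its positive part, since the integral of the
    negative part enters with a minus sign. *)
Lemma le_lower_integral (f g : T -> \bar R) :
  (forall x, D x -> 0 <= g x) -> (forall x, D x -> f x <= g x) ->
  \int[mu]_(x in D) f x <= \int[mu]_(x in D) g x.
Proof.
move=> g0 fg; rewrite integralE.
apply: (@le_trans _ _ (\int[mu]_(x in D) f^\+ x)).
  by rewrite geeDl// leeNl oppe0 integral_ge0.
apply: ge0_le_lower_integral => // x Dx.
by rewrite funeposE ge_max fg ?g0.
Qed.

End integral_without_measurability.

(** * Integration on the half-line *)

Definition pair_integral {R : realType}
    (mu : {measure set (measurableTypeR R) -> \bar R}) (k : R -> R -> R) : \bar R :=
  (\int[mu]_(x in pos_half_line R) \int[mu]_(y in pos_half_line R) (k x y)%:E)%E.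

Definition cutoff {R : realType} (N : R) (phi : R -> R) (x : R) : R :=
  if x <= N then phi x else 0.

Section half_line.
Context {R : realType}.
Implicit Types (mu : {measure set (measurableTypeR R) -> \bar R}).
Local Notation pos := (pos_half_line R).

Lemma pos_half_lineP (x : R) : pos x <-> 0 < x.
Proof. by rewrite /pos_half_line /= in_itv /= andbT. Qed.

Lemma measurable_pos_half_line : measurable pos.
Proof. exact: measurable_itv. Qed.
Hint Resolve measurable_pos_half_line : core.

Lemma measurable_cutoff (N : R) (phi : R -> R) :
  measurable_fun pos phi -> measurable_fun pos (cutoff N phi).
Proof.
move=> mphi; apply: measurable_fun_if => //.
- apply: measurable_fun_ler => //.
- exact: measurable_funS mphi.
Qed.

Lemma cutoff_ge0 (N : R) (phi : R -> R) :
  (forall x, 0 < x -> 0 <= phi x) -> forall x, 0 < x -> 0 <= cutoff N phi x.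
Proof. by move=> p0 x x0; rewrite /cutoff; case: ifP => // _; exact: p0. Qed.

Lemma cutoff_le (N : R) (phi : R -> R) :
  (forall x, 0 < x -> 0 <= phi x) -> forall x, 0 < x -> cutoff N phi x <= phi x.
Proof. by move=> p0 x x0; rewrite /cutoff; case: ifP => // _; exact: p0. Qed.

Lemma le_integral_pos mu (f g : R -> R) :
  (forall x, 0 < x -> 0 <= f x) -> (forall x, 0 < x -> f x <= g x) ->
  (\int[mu]_(x in pos) (f x)%:E <= \int[mu]_(x in pos) (g x)%:E)%E.
Proof.
by move=> f0 fg; apply: ge0_le_lower_integral => x /pos_half_lineP x0;
  rewrite lee_fin; [exact: f0|exact: fg].
Qed.

(** Monotone convergence: the cut-offs at the integers increase to [phi]. *)
Lemma integral_le_cutoff mu (phi : R -> R) (C : \bar R) :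
  measurable_fun pos phi -> (forall x, 0 < x -> 0 <= phi x) ->
  (forall n : nat, \int[mu]_(x in pos) (cutoff n%:R phi x)%:E <= C)%E ->
  (\int[mu]_(x in pos) (phi x)%:E <= C)%E.
Proof.
move=> mphi phi0 cutoffC.
have cvgphi x : limn (fun n : nat => (cutoff n%:R phi x)%:E) = (phi x)%:E.
  apply/cvg_lim => //; apply: cvg_near_cst; near=> n.
  rewrite /cutoff ifT//; near: n; exact: nbhs_infty_ger.
under eq_integral do rewrite -cvgphi.
have mcutoff n : measurable_fun pos (fun x => (cutoff n%:R phi x)%:E).
  by apply/measurable_EFinP; exact: measurable_cutoff.
have cutoff0 (n : nat) x : pos x -> (0 <= (cutoff n%:R phi x)%:E)%E.
  by move=> /pos_half_lineP x0; rewrite lee_fin; exact: cutoff_ge0.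
have ndcutoff x : pos x ->
    {homo (fun n : nat => (cutoff n%:R phi x)%:E) : n m / (n <= m)%N >-> (n <= m)%E}.
  move=> /pos_half_lineP x0 n m nm; rewrite lee_fin /cutoff; case: ifP => [xn|_].
    by rewrite ifT// (le_trans xn)// ler_nat.
  by case: ifP => // _; exact: phi0.
rewrite monotone_convergence//; apply: lime_le; last exact: nearW.
by apply/cvg_ex; eexists; exact: cvg_monotone_convergence.
Unshelve. all: by end_near. Qed.

End half_line.

(** * Double integrals of kernels, and integrals over time *)

Section pair_integral.
Context {R : realType}.
Implicit Types (mu : {measure set (measurableTypeR R) -> \bar R}).
Local Notation pos := (pos_half_line R).
Hint Resolve measurable_pos_half_line : core.

Lemma EFin_ge0_pos (f : R -> R) :
  (forall x, 0 < x -> 0 <= f x) -> forall x, pos x -> (0 <= (f x)%:E)%E.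
Proof. by move=> f0 x /pos_half_lineP x0; rewrite lee_fin f0. Qed.

Lemma integral_lincomb_le mu (u v U V : R) (f g : R -> R) :
  0 <= u -> 0 <= v ->
  measurable_fun pos f -> measurable_fun pos g ->
  (forall x, 0 < x -> 0 <= f x) -> (forall x, 0 < x -> 0 <= g x) ->
  (\int[mu]_(x in pos) (f x)%:E <= U%:E)%E ->
  (\int[mu]_(x in pos) (g x)%:E <= V%:E)%E ->
  (\int[mu]_(x in pos) (u * f x + v * g x)%:E <= (u * U + v * V)%:E)%E.
Proof.
move=> u0 v0 mf mg /EFin_ge0_pos f0 /EFin_ge0_pos g0 fU gV.
have mEf : measurable_fun pos (EFin \o f) by exact/measurable_EFinP.
have mEg : measurable_fun pos (EFin \o g) by exact/measurable_EFinP.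
under eq_integral do rewrite EFinD !EFinM.
rewrite ge0_integralD//.
- by rewrite !ge0_integralZl_EFin// EFinD !EFinM leeD// lee_wpmul2l.
- by move=> x posx; rewrite mule_ge0// f0.
- exact: measurable_funeM.
- by move=> x posx; rewrite mule_ge0// g0.
- exact: measurable_funeM.
Qed.

Lemma pair_integral_ge0 mu (k : R -> R -> R) :
  (forall x y, 0 < x -> 0 < y -> 0 <= k x y) -> (0 <= pair_integral mu k)%E.
Proof.
move=> k0; apply: integral_ge0 => x /pos_half_lineP x0.
by apply: integral_ge0 => y /pos_half_lineP y0; rewrite lee_fin k0.
Qed.

Lemma pair_integral_le0N mu (k : R -> R -> R) :
  (forall x y, 0 < x -> 0 < y -> k x y <= 0) ->
  pair_integral mu k = (- pair_integral mu (fun x y => - k x y)%R)%E.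
Proof.
move=> k0; rewrite /pair_integral -integral_ge0N; last first.
  move=> x /pos_half_lineP x0; apply: integral_ge0 => y /pos_half_lineP y0.
  by rewrite lee_fin oppr_ge0 k0.
apply: eq_integral => x /set_mem/pos_half_lineP x0.
rewrite -integral_ge0N; last first.
  by move=> y /pos_half_lineP y0; rewrite lee_fin oppr_ge0 k0.
by apply: eq_integral => y _; rewrite -EFinN opprK.
Qed.

(** The bound on [k] is a sum of products of one-variable functions, so each of the
    two integrations only uses linearity in one variable. *)
Lemma pair_integral_le mu (k : R -> R -> R) (a b : R -> R) (A B : R) :
  measurable_fun pos a -> measurable_fun pos b ->
  (forall x, 0 < x -> 0 <= a x) -> (forall x, 0 < x -> 0 <= b x) ->
  (forall x y, 0 < x -> 0 < y -> k x y <= a x * b y + b x * a y) ->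
  (\int[mu]_(x in pos) (a x)%:E <= A%:E)%E ->
  (\int[mu]_(x in pos) (b x)%:E <= B%:E)%E ->
  (pair_integral mu k <= (2 * A * B)%:E)%E.
Proof.
move=> ma mb a0 b0 kab aA bB.
have A0 : 0 <= A.
  rewrite -lee_fin; apply: le_trans aA; apply: integral_ge0 => x /pos_half_lineP.
  by rewrite lee_fin; exact: a0.
have B0 : 0 <= B.
  rewrite -lee_fin; apply: le_trans bB; apply: integral_ge0 => x /pos_half_lineP.
  by rewrite lee_fin; exact: b0.
apply: (@le_trans _ _ (\int[mu]_(x in pos) (B * a x + A * b x)%:E)%E).
  apply: le_lower_integral => x /pos_half_lineP x0.
    by rewrite lee_fin addr_ge0// mulr_ge0// ?a0 ?b0.
  apply: (@le_trans _ _ (\int[mu]_(y in pos) (a x * b y + b x * a y)%:E)%E).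
    apply: le_lower_integral => y /pos_half_lineP y0; rewrite lee_fin ?kab//.
    by rewrite addr_ge0// mulr_ge0// ?a0 ?b0.
  rewrite [B * _]mulrC [A * _]mulrC; by apply: integral_lincomb_le; rewrite ?a0 ?b0.
apply: (@le_trans _ _ (B * A + A * B)%:E); first exact: integral_lincomb_le.
by rewrite lee_fin; lra.
Qed.

Lemma pair_integral_ge mu (k : R -> R -> R) (a : R -> R) (A : R) :
  measurable_fun pos a -> (forall x, 0 < x -> 0 <= a x) ->
  (forall x y, 0 < x -> 0 < y -> a x * a y <= k x y) ->
  (\int[mu]_(x in pos) (a x)%:E = A%:E)%E ->
  ((A ^+ 2)%:E <= pair_integral mu k)%E.
Proof.
move=> ma a0 ak aA.
have a0E x : pos x -> (0 <= (a x)%:E)%E.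
  by move=> /pos_half_lineP x0; rewrite lee_fin a0.
have mEa : measurable_fun pos (EFin \o a) by exact/measurable_EFinP.
have A0 : 0 <= A by rewrite -lee_fin -aA; exact: integral_ge0.
have <- : (\int[mu]_(x in pos) (A%:E * (a x)%:E) = (A ^+ 2)%:E)%E.
  by rewrite ge0_integralZl_EFin// aA.
apply: ge0_le_lower_integral => x posx; first by rewrite mule_ge0// a0E.
rewrite muleC -aA -ge0_integralZl_EFin//; last exact/a0/pos_half_lineP.
apply: ge0_le_lower_integral => y posy; first by rewrite mule_ge0 ?a0E.
by rewrite lee_fin; apply: ak; exact/pos_half_lineP.
Qed.

End pair_integral.

Lemma integral_itv_derive {R : realType} (F f : R -> R) (t : R) :
  0 <= t -> (forall s : R, is_derive s 1 F (f s)) -> continuous f ->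
  (\int[@lebesgue_measure R]_(s in `[0%R, t]) (f s)%:E = (F t - F 0)%:E)%E.
Proof.
rewrite le_eqVlt => /predU1P[<-|t0] dF cf.
  by rewrite set_itv1 integral_set1 subrr.
have cF : continuous F.
  move=> s; apply: differentiable_continuous; apply/derivable1_diffP.
  exact: (@ex_derive _ _ _ _ _ _ _ (dF s)).
rewrite (@continuous_FTC2 _ f F)//.
- exact: continuous_subspaceT.
- split.
  + by move=> s _; exact: (@ex_derive _ _ _ _ _ _ _ (dF s)).
  + exact/cvg_at_right_filter/cF.
  + exact/cvg_at_left_filter/cF.
- by move=> s _; rewrite derive1E; exact: (@derive_val _ _ _ _ _ _ _ (dF s)).
Qed.

Lemma integral_itv_cst {R : realType} (t c : R) : 0 <= t ->
  (\int[@lebesgue_measure R]_(s in `[0%R, t]) c%:E = (t * c)%:E)%E.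
Proof.
rewrite integral_cst//= lebesgue_measure_itv/= lte_fin le_eqVlt.
move=> /predU1P[<-|t0]; first by rewrite ltxx mule0 mul0r.
by rewrite t0 -EFinD subr0 -EFinM mulrC.
Qed.

(** * Subadditive test functions *)

Definition test_function {R : realType} (psi : R -> R) : Prop :=
  [/\ measurable_fun (pos_half_line R) psi,
      forall x : R, 0 < x -> 0 <= psi x
    & exists C : R, forall x : R, 0 < x -> psi x <= C].

Lemma test_function_cutoff {R : realType} (N : R) (phi : R -> R) :
  measurable_fun (pos_half_line R) phi -> (forall x, 0 < x -> 0 <= phi x) ->
  (exists C : R, forall x, 0 < x -> x <= N -> phi x <= C) ->
  test_function (cutoff N phi).
Proof.
move=> mphi phi0 [C phiC]; split; [exact: measurable_cutoff|exact: cutoff_ge0|].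
exists (Num.max C 0) => x x0; rewrite /cutoff le_max; case: ifP => xN.
  by rewrite phiC.
by rewrite lexx orbT.
Qed.

Lemma DeltaC {R : realType} (psi : R -> R) (x y : R) :
  Delta psi x y = Delta psi y x.
Proof. by rewrite /Delta [x + y]addrC addrAC. Qed.

Lemma Delta_cutoff {R : realType} (N : R) (phi : R -> R) (x y : R) :
  0 < x -> 0 < y -> x + y <= N ->
  Delta (cutoff N phi) x y = Delta phi x y.
Proof.
move=> x0 y0 xyN; rewrite /Delta /cutoff xyN.
have -> : x <= N by lra.
by have -> : y <= N by lra.
Qed.

(** The merged particle leaves the support of the cut-off: only losses remain. *)
Lemma Delta_cutoff_le0 {R : realType} (N : R) (phi : R -> R) (x y : R) :
  (forall z, 0 < z -> 0 <= phi z) -> 0 < x -> 0 < y -> N < x + y ->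
  Delta (cutoff N phi) x y <= 0.
Proof.
move=> phi0 x0 y0 xyN; rewrite /Delta.
have -> : cutoff N phi (x + y) = 0 by rewrite /cutoff leNgt xyN.
have := cutoff_ge0 N phi phi0 x x0; have := cutoff_ge0 N phi phi0 y y0; lra.
Qed.

Section dissipation.
Context {R : realType} {K : R -> R -> R}.
Context {f : R -> {measure set (measurableTypeR R) -> \bar R}}.
Hypothesis hK : coagulation_kernel K.
Hypothesis hf : weak_solution K f.
Local Notation pos := (pos_half_line R).
Implicit Types psi : R -> R.

Let K_ge0 (x y : R) : 0 < x -> 0 < y -> 0 <= K x y.
Proof. by case: hK => _ + _; exact. Qed.

(** Twice the amount of [\int psi] lost up to time [t]. *)
Definition dissipation psi (t : R) : \bar R :=
  (\int[@lebesgue_measure R]_(s in `[0%R, t])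
     pair_integral (f s) (fun x y => - (Delta psi x y * K x y))%R)%E.

Definition subadditive_pos psi :=
  forall x y : R, 0 < x -> 0 < y -> Delta psi x y <= 0.

Let loss_ge0 psi (x y : R) : subadditive_pos psi -> 0 < x -> 0 < y ->
  0 <= - (Delta psi x y * K x y).
Proof. by move=> sub x0 y0; rewrite oppr_ge0 mulr_le0_ge0 ?sub ?K_ge0. Qed.

Lemma dissipation_ge0 psi t : subadditive_pos psi -> (0 <= dissipation psi t)%E.
Proof.
move=> sub; apply: integral_ge0 => s _; apply: pair_integral_ge0 => x y x0 y0.
exact: loss_ge0.
Qed.

Lemma le_dissipation psi s t : subadditive_pos psi -> s <= t ->
  (dissipation psi s <= dissipation psi t)%E.
Proof.
move=> sub st; rewrite /dissipation [leLHS]integral_mkcond [leRHS]integral_mkcond.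
have J0 r : (0 <= pair_integral (f r) (fun x y => - (Delta psi x y * K x y))%R)%E.
  by apply: pair_integral_ge0 => x y x0 y0; exact: loss_ge0.
apply: ge0_le_lower_integral => r _.
  by apply: erestrict_ge0 => *; exact: J0.
rewrite /patch; case: ifPn => [|_]; last by case: ifP => // _; exact: J0.
rewrite inE/= in_itv/= => /andP[r0 rs].
by rewrite ifT// inE/= in_itv/= r0 (le_trans rs).
Qed.

(** The weak equation with the loss term moved to the left, so that all terms are
    nonnegative.  Finiteness of the initial term excludes [+oo - oo]. *)
Lemma balance psi t : test_function psi -> subadditive_pos psi -> 0 <= t ->
  (\int[f 0%R]_(x in pos) (psi x)%:E < +oo)%E ->
  (\int[f t]_(x in pos) (psi x)%:E + 2^-1%:E * dissipation psi t =
   \int[f 0%R]_(x in pos) (psi x)%:E)%E.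
Proof.
move=> [mpsi psi0 psiC] sub t0.
have J0 := dissipation_ge0 psi t sub.
have A0 : (0 <= \int[f 0%R]_(x in pos) (psi x)%:E)%E.
  by apply: integral_ge0 => x posx; exact: EFin_ge0_pos.
have : (0 <= \int[f t]_(x in pos) (psi x)%:E)%E.
  by apply: integral_ge0 => x posx; exact: EFin_ge0_pos.
have -> : (\int[f t]_(x in pos) (psi x)%:E =
    \int[f 0%R]_(x in pos) (psi x)%:E - 2^-1%:E * dissipation psi t)%E.
  case: hf => _ _ /(_ psi mpsi psi0 psiC t t0) ->.
  congr (_ + _)%E; rewrite -muleN; congr (_ * _)%E.
  rewrite /dissipation -integral_ge0N; last first.
    by move=> s _; apply: pair_integral_ge0 => x y x0 y0; exact: loss_ge0.
  apply: eq_integral => s _; rewrite -pair_integral_le0N// => x y x0 y0.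
  by rewrite -oppr_ge0; exact: loss_ge0.
move: (\int[f 0%R]_(x in pos) (psi x)%:E)%E (dissipation psi t) A0 J0.
move=> [a| |] [j| |] //= a0 j0.
- by move=> _ _; rewrite -!EFinM -EFinB -EFinD subrK.
- by rewrite mulry gtr0_sg// mul1e.
Qed.

(** The dissipation up to time [s] is finite and can be cancelled between the
    balances at times [s] and [t]. *)
Lemma integral_nonincreasing psi s t :
  test_function psi -> subadditive_pos psi -> 0 <= s -> s <= t ->
  (\int[f 0%R]_(x in pos) (psi x)%:E < +oo)%E ->
  (\int[f t]_(x in pos) (psi x)%:E <= \int[f s]_(x in pos) (psi x)%:E)%E.
Proof.
move=> tpsi sub s0 st fin0.
have hJs0 : (0 <= 2^-1%:E * dissipation psi s)%E.
  by rewrite mule_ge0// dissipation_ge0.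
have Xs0 : (0 <= \int[f s]_(x in pos) (psi x)%:E)%E.
  by apply: integral_ge0 => x posx; case: tpsi => _ /EFin_ge0_pos + _; exact.
have hJs_fin : (2^-1%:E * dissipation psi s)%E \is a fin_num.
  rewrite ge0_fin_numE//; apply: (le_lt_trans _ fin0).
  by rewrite -(balance psi s tpsi sub s0 fin0) leeDr.
rewrite -(leeD2rE _ _ hJs_fin) (balance psi s)//.
rewrite -(balance psi t tpsi sub (le_trans s0 st) fin0) leeD2l//.
by rewrite lee_wpmul2l ?le_dissipation.
Qed.

End dissipation.

(** * Logarithmic inequalities *)

Section logarithms.
Context {R : realType}.
Implicit Types x y z : R.

Definition log_e x : R := ln (expR 1 + x).

Lemma log_e_ge1 x : 0 <= x -> 1 <= log_e x.
Proof.
move=> x0; have e0 := expR_gt0 (1 : R).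
by rewrite -[leLHS]expRK ler_ln ?posrE//; lra.
Qed.

Lemma le_log_e x y : 0 <= x -> x <= y -> log_e x <= log_e y.
Proof.
move=> x0 xy; have e0 := expR_gt0 (1 : R).
by rewrite /log_e ler_ln ?posrE//; lra.
Qed.

(** Concavity: the tangent line of the logarithm at [exp c], evaluated at [e + z], is
    the right-hand side plus [exp (1 - c) - 1 <= 0].  This linearizes the logarithm
    of the kernel, [c] being chosen later as a function of time. *)
Lemma log_e_le_tangent (c z : R) : 1 <= c -> 0 <= z ->
  log_e z <= c + z * expR (- c).
Proof.
move=> c1 z0; have e0 := expR_gt0 (1 : R); have ec0 := expR_gt0 c.
have eNc0 := expR_gt0 (- c).
apply: (@le_trans _ _ (ln (expR c * (1 + z * expR (- c))))).
  have u0 : 0 <= z * expR (- c) by rewrite mulr_ge0// ltW.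
  rewrite ler_ln ?posrE//; [|lra|by apply: mulr_gt0 => //; lra].
  by rewrite mulrDr mulr1 mulrCA -expRD subrr expR0 mulr1 lerD2r ler_expR.
have u0 : 0 <= z * expR (- c) by rewrite mulr_ge0// ltW.
rewrite lnM ?posrE//; last lra.
by rewrite expRK lerD2l le_ln1Dx//; lra.
Qed.

Lemma ln_ge_1BV z : 0 < z -> 1 - z^-1 <= ln z.
Proof.
move=> z0; have zV0 : 0 < z^-1 by rewrite invr_gt0.
have : ln (1 + (z^-1 - 1)) <= z^-1 - 1 by apply: le_ln1Dx; lra.
have -> : 1 + (z^-1 - 1) = z^-1 by lra.
rewrite lnV ?posrE//; lra.
Qed.

Lemma log_e_double_le y : 0 < y -> log_e (y + y) <= log_e y + log_e y.
Proof.
move=> y0; have e1 : 1 < expR (1 : R) by rewrite expR_gt1.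
rewrite /log_e -lnM ?posrE; [|lra|lra].
rewrite ler_ln ?posrE; [|lra|apply: mulr_gt0; lra].
nra.
Qed.

Lemma log_e_double_ge y : 0 < y ->
  y / (expR 1 + (y + y)) <= log_e (y + y) - log_e y.
Proof.
move=> y0; have e0 := expR_gt0 (1 : R).
rewrite /log_e -ln_div ?posrE; [|lra|lra].
apply: le_trans (ln_ge_1BV _ _); last by apply: divr_gt0; lra.
rewrite invf_div le_eqVlt; apply/orP; left; apply/eqP.
have : expR 1 + (y + y) != 0 by rewrite gt_eqF//; lra.
move=> h; field.
exact: h.
Qed.

(** Tangent line inequality for the convex function [t ^ (- beta)] at [b]; it
    reduces to [1 + z <= exp z] by taking logarithms. *)
Lemma powRN_diff_ge (a b beta : R) : 0 < a -> a <= b -> 0 < beta ->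
  beta * (b - a) * b `^ (- (beta + 1)) <= a `^ (- beta) - b `^ (- beta).
Proof.
move=> a0 ab beta0; have b0 : 0 < b := lt_le_trans a0 ab.
have pb0 : 0 < b `^ (- beta) := powR_gt0 _ b0.
have -> : b `^ (- (beta + 1)) = b `^ (- beta) / b.
  rewrite opprD powRD; last by rewrite (gt_eqF b0) implybT.
  by rewrite powR_inv1 ?ltW.
have -> : a `^ (- beta) = b `^ (- beta) * expR (beta * ln (b / a)).
  rewrite /powR !gt_eqF// -expRD ln_div ?posrE//; congr expR; lra.
set P := b `^ (- beta) in pb0 *.
have -> : beta * (b - a) * (P / b) = P * (beta * ((b - a) / b)) by ring.
have -> : P * expR (beta * ln (b / a)) - P = P * (expR (beta * ln (b / a)) - 1).
  by ring.
rewrite ler_pM2l//.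
apply: (@le_trans _ _ (beta * ln (b / a))); last first.
  by have := expR_ge1Dx (beta * ln (b / a)); lra.
rewrite ler_pM2l//.
apply: le_trans (ln_ge_1BV _ (divr_gt0 b0 a0)).
by rewrite invf_div mulrBl mulfV// gt_eqF.
Qed.

End logarithms.

(** * The entropy *)

Section gelling_weight.
Context {R : realType} {alpha : R}.
Hypothesis alpha1 : 1 < alpha.
Implicit Types x y z : R.

Definition tail_const : R := (expR 1 + 2) * 2 `^ alpha / (alpha - 1).

(** The difference of logarithms makes [weight] decrease enough on masses below one,
    the negative power on masses above one; the factors [4] and [tail_const] are
    tuned so that [ln_ratio_double] and [log_e_tail_double] have constant one. *)
Definition weight x : R :=
  4 * (ln (1 + x) - ln x) + tail_const * log_e x `^ (- (alpha - 1)).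

Lemma tail_const_gt0 : 0 < tail_const.
Proof.
have a1 := alpha1; have e0 := expR_gt0 (1 : R).
have p0 : 0 < 2 `^ alpha :> R by rewrite powR_gt0.
by rewrite divr_gt0 ?mulr_gt0//; lra.
Qed.

Lemma ln_ratioE x : 0 < x -> ln (1 + x) - ln x = ln (1 + x^-1).
Proof.
move=> x0; rewrite -ln_div ?posrE//; last lra.
by rewrite mulrDl mulfV ?gt_eqF// mul1r addrC.
Qed.

Lemma ln_ratio_le x : 0 < x -> ln (1 + x) - ln x <= x^-1.
Proof.
move=> x0; rewrite ln_ratioE// le_ln1Dx//.
have : 0 < x^-1 by rewrite invr_gt0.
lra.
Qed.

Lemma ln_ratio_ge0 x : 0 < x -> 0 <= ln (1 + x) - ln x.
Proof. by move=> x0; rewrite subr_ge0 ler_ln ?posrE//; lra. Qed.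

Lemma weight_ge0 x : 0 < x -> 0 <= weight x.
Proof.
move=> x0; rewrite addr_ge0// mulr_ge0 ?ln_ratio_ge0 ?powR_ge0//.
exact: ltW tail_const_gt0.
Qed.

Lemma le_ln_ratio x z : 0 < x -> x <= z -> ln (1 + z) - ln z <= ln (1 + x) - ln x.
Proof.
move=> x0 xz; have z0 : 0 < z by lra.
have zV0 : 0 < z^-1 by rewrite invr_gt0.
have xV0 : 0 < x^-1 by rewrite invr_gt0.
by rewrite !ln_ratioE// ler_ln ?posrE ?lerD2l ?lef_pV2 ?posrE//; lra.
Qed.

Lemma le_powRN (a b c : R) : 0 < a -> a <= b -> 0 <= c -> b `^ (- c) <= a `^ (- c).
Proof.
move=> a0 ab c0; have b0 : 0 < b by lra.
rewrite !powRN lef_pV2 ?posrE ?powR_gt0//.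
by apply: ge0_ler_powR; rewrite ?nnegrE//; exact: ltW.
Qed.

Lemma le_log_e_powRN x z (c : R) : 0 < x -> x <= z -> 0 <= c ->
  log_e z `^ (- c) <= log_e x `^ (- c).
Proof.
move=> x0 xz c0; have := log_e_ge1 _ (ltW x0).
by move=> L1; apply: le_powRN => //; [lra|exact: le_log_e (ltW x0) xz].
Qed.

Lemma log_e_powRN_le1 x (c : R) : 0 < x -> 0 <= c -> log_e x `^ (- c) <= 1.
Proof.
move=> x0 c0; have := log_e_ge1 _ (ltW x0) => L1.
by rewrite -[leRHS](@powRr0 _ (log_e x)) ler_powR//; lra.
Qed.

Lemma weight_nonincreasing x z : 0 < x -> x <= z -> weight z <= weight x.
Proof.
move=> x0 xz; have a1 := alpha1; have c0 := tail_const_gt0.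
have := le_ln_ratio _ _ x0 xz.
have : tail_const * log_e z `^ (- (alpha - 1)) <=
       tail_const * log_e x `^ (- (alpha - 1)).
  by rewrite ler_pM2l// le_log_e_powRN//; lra.
rewrite /weight; lra.
Qed.

Lemma ln_ratio_double y : 0 < y -> y <= 1 ->
  1 <= 4 * (ln (1 + y) - ln y) - 4 * (ln (1 + (y + y)) - ln (y + y)).
Proof.
move=> y0 y1.
have -> : ln (y + y) = ln 2 + ln y by rewrite -lnM ?posrE//; congr ln; lra.
have -> : 4 * (ln (1 + y) - ln y) - 4 * (ln (1 + (y + y)) - (ln 2 + ln y)) =
  4 * ((ln 2 + ln (1 + y)) - ln (1 + (y + y))) by ring.
rewrite -lnM ?posrE//; last lra.
rewrite -ln_div ?posrE; [|lra|lra].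
have q0 : 0 < 2 * (1 + y) / (1 + (y + y)) by apply: divr_gt0; lra.
have := ln_ge_1BV _ q0; rewrite invf_div => lnq.
have : 1 / 4 <= 1 - (1 + (y + y)) / (2 * (1 + y)).
  rewrite lerBrDr -lerBrDl ler_pdivrMr; lra.
lra.
Qed.

(** By [powRN_diff_ge] the right-hand side is at least
    [(e + 2) 2 ^ alpha (log_e (2 y) - log_e y) log_e (2 y) ^ (- alpha)]; here
    [log_e (2 y) - log_e y >= y / (e + 2 y) >= 1 / (e + 2)] as [y >= 1], and
    [log_e (2 y) <= 2 log_e y]. *)
Lemma log_e_tail_double y : 1 <= y -> log_e y `^ (- alpha) <=
  tail_const * log_e y `^ (- (alpha - 1))
  - tail_const * log_e (y + y) `^ (- (alpha - 1)).
Proof.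
move=> y1; have a1 := alpha1; have y0 : 0 < y by lra.
have e0 := expR_gt0 (1 : R).
have La1 := log_e_ge1 _ (ltW y0).
have Lab : log_e y <= log_e (y + y) by apply: le_log_e; lra.
have Lb2 := log_e_double_le _ y0.
have diff : (expR 1 + 2)^-1 <= log_e (y + y) - log_e y.
  apply: le_trans (log_e_double_ge _ y0).
  have ey : expR 1 * 1 <= expR 1 * y by rewrite ler_pM2l.
  have e2 : 0 < expR 1 + 2 :> R by lra.
  have ey2 : 0 < expR 1 + (y + y) by lra.
  rewrite (ler_pdivlMr _ _ ey2) mulrC (ler_pdivrMr _ _ e2); lra.
have beta0 : 0 < alpha - 1 by lra.
have a0 : 0 < log_e y by lra.
have := powRN_diff_ge _ _ _ a0 Lab beta0; rewrite subrK => tail.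
have bN : 2 `^ (- alpha) * log_e y `^ (- alpha) <= log_e (y + y) `^ (- alpha).
  rewrite -powRM//; last lra.
  by apply: le_powRN; lra.
have p0 : 0 < log_e y `^ (- alpha) by rewrite powR_gt0.
have t0 : 0 < 2 `^ (- alpha) :> R by rewrite powR_gt0.
have t1 : 2 `^ alpha * 2 `^ (- alpha) = 1 :> R.
  by rewrite powRN mulfV// gt_eqF// powR_gt0.
rewrite -mulrBr /tail_const.
have c0 := tail_const_gt0.
have lower : (alpha - 1) * (expR 1 + 2)^-1 *
    (2 `^ (- alpha) * log_e y `^ (- alpha)) <=
    log_e y `^ (- (alpha - 1)) - log_e (y + y) `^ (- (alpha - 1)).
  apply: le_trans tail; apply: ler_pM => //.
  - by rewrite mulr_ge0 ?invr_ge0; lra.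
  - by rewrite mulr_ge0 ?ltW.
  - by rewrite ler_pM2l.
have -> : log_e y `^ (- alpha) = tail_const * ((alpha - 1) * (expR 1 + 2)^-1 *
    (2 `^ (- alpha) * log_e y `^ (- alpha))).
  rewrite /tail_const; set P := log_e y `^ _.
  transitivity ((expR 1 + 2) / (expR 1 + 2) * ((alpha - 1) / (alpha - 1))
    * (2 `^ alpha * 2 `^ (- alpha)) * P); last by ring.
  by rewrite t1 !mulfV ?mul1r ?gt_eqF//; lra.
by rewrite ler_pM2l.
Qed.

Lemma weight_double y : 0 < y -> log_e y `^ (- alpha) <= weight y - weight (y + y).
Proof.
move=> y0; have a1 := alpha1; have c0 := tail_const_gt0; rewrite /weight.
have [y1|/ltW y1] := leP y 1.
- have := ln_ratio_double _ y0 y1.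
  have := log_e_powRN_le1 y alpha y0 (ltW (lt_trans ltr01 alpha1)).
  have : tail_const * log_e (y + y) `^ (- (alpha - 1)) <=
       tail_const * log_e y `^ (- (alpha - 1)).
    by rewrite ler_pM2l// le_log_e_powRN//; lra.
  lra.
- have := log_e_tail_double _ y1.
  have := le_ln_ratio y (y + y) y0; lra.
Qed.

Definition entropy x : R := x * weight x.

Lemma entropy_ge0 x : 0 < x -> 0 <= entropy x.
Proof. by move=> x0; rewrite mulr_ge0 ?weight_ge0// ltW. Qed.

(** If [y <= x] then [x + y >= 2 y], and the monotonicity of [weight] reduces the
    inequality to [weight_double], the mass [x] only contributing a loss. *)
Lemma Delta_entropy x y : 0 < x -> 0 < y ->
  Delta entropy x y <= - (Num.min x y * log_e (Num.min x y) `^ (- alpha)).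
Proof.
wlog yx : x y / y <= x => [H x0 y0|x0 y0].
  have /orP[yx|xy] := le_total y x; first exact: H.
  by rewrite DeltaC minC; exact: H.
rewrite min_r//.
have wx : weight (x + y) <= weight x by apply: weight_nonincreasing; lra.
have wy : weight (x + y) <= weight (y + y) by apply: weight_nonincreasing; lra.
have dx : x * weight (x + y) <= x * weight x by rewrite ler_pM2l.
have : y * log_e y `^ (- alpha) <= y * (weight y - weight (x + y)).
  by rewrite ler_pM2l//; have := weight_double _ y0; lra.
rewrite /Delta /entropy; lra.
Qed.

Lemma entropy_le_bounded x : 0 < x -> entropy x <= 4 + tail_const * x.
Proof.
move=> x0; have a1 := alpha1; have c0 := tail_const_gt0.
have r : x * (ln (1 + x) - ln x) <= 1.
  by rewrite -[leRHS](@mulfV _ x) ?gt_eqF// ler_pM2l// ln_ratio_le.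
have p1 : log_e x `^ (- (alpha - 1)) <= 1 by apply: log_e_powRN_le1 => //; lra.
have : tail_const * x * log_e x `^ (- (alpha - 1)) <= tail_const * x * 1.
  by rewrite ler_pM2l// mulr_gt0.
rewrite /entropy /weight; lra.
Qed.

(** The initial entropy is finite under the moment hypotheses of the gelling
    criterion. *)
Lemma entropy_le x : 0 < x -> entropy x <=
  4 * (x * `|ln x| * \1_[set z : R | z < 1] x) + (4 + tail_const) * x.
Proof.
move=> x0; have a1 := alpha1; have c0 := tail_const_gt0.
have p1 : log_e x `^ (- (alpha - 1)) <= 1 by apply: log_e_powRN_le1 => //; lra.
have : tail_const * x * log_e x `^ (- (alpha - 1)) <= tail_const * x * 1.
  by rewrite ler_pM2l// mulr_gt0.
rewrite indicE; have [x1|x1] := ltP x 1.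
  rewrite mem_set//= mulr1.
  have l1 : ln (1 + x) <= x by apply: le_ln1Dx; lra.
  have : x * (ln (1 + x) - ln x) <= x * (1 + `|ln x|).
    by rewrite ler_pM2l//; have := ler_norm (- ln x); rewrite normrN; lra.
  rewrite /entropy /weight; lra.
rewrite memNset/=; last by rewrite /=; apply/negP; rewrite -leNgt.
rewrite mulr0.
have r : x * (ln (1 + x) - ln x) <= 1.
  by rewrite -[leRHS](@mulfV _ x) ?gt_eqF// ler_pM2l// ln_ratio_le.
rewrite /entropy /weight; lra.
Qed.

Lemma measurable_entropy : measurable_fun (pos_half_line R) entropy.
Proof.
have ml (c : R) : measurable_fun [set: R] (fun x : R => ln (c + x)).
  by apply: measurableT_comp; [exact: measurable_ln|exact: measurable_funD].
apply: measurable_funTS.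
apply: measurable_funM => //; apply: measurable_funD.
  apply: measurable_funM => //; apply: measurable_funB; first exact: ml.
  exact: measurable_ln.
apply: measurable_funM => //.
by apply: (measurableT_comp (measurable_powR _)); exact: ml.
Qed.

End gelling_weight.

(** * Mass is nonincreasing *)

Section mass.
Context {R : realType} {K : R -> R -> R}.
Context {f : R -> {measure set (measurableTypeR R) -> \bar R}}.
Hypothesis hK : coagulation_kernel K.
Hypothesis hf : weak_solution K f.
Local Notation pos := (pos_half_line R).

Lemma moment_exprn (mu : {measure set (measurableTypeR R) -> \bar R}) (n : nat) :
  moment n%:R mu = (\int[mu]_(x in pos) (x ^+ n)%:E)%E.
Proof.
apply: eq_integral => x /set_mem/pos_half_lineP x0.
by rewrite powR_mulrn// ltW.
Qed.

Lemma moment1E (mu : {measure set (measurableTypeR R) -> \bar R}) :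
  moment 1 mu = (\int[mu]_(x in pos) x%:E)%E.
Proof. exact: (moment_exprn mu 1). Qed.

Lemma subadditive_cutoff_id (N : R) : subadditive_pos (cutoff N id).
Proof.
move=> x y x0 y0; have [xyN|xyN] := leP (x + y) N.
  by rewrite Delta_cutoff// /Delta addrAC addrK subrr.
by apply: Delta_cutoff_le0 => // z /ltW.
Qed.

Lemma test_function_cutoff_id (N : R) : test_function (cutoff N id).
Proof.
apply: test_function_cutoff; first exact: measurable_id.
  by move=> x /ltW.
by exists N.
Qed.

Lemma integral_cutoff_id_le (mu : {measure set (measurableTypeR R) -> \bar R}) (N : R) :
  (\int[mu]_(x in pos) (cutoff N id x)%:E <= moment 1 mu)%E.
Proof.
rewrite moment1E; apply: le_integral_pos; first by apply: cutoff_ge0 => x /ltW.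
by apply: cutoff_le => x /ltW.
Qed.

(** [x] cut off at [n] is subadditive, so that its integral decreases; let [n] tend
    to infinity. *)
Lemma mass_nonincreasing t : 0 <= t ->
  (moment 1 (f 0%R) < +oo)%E -> (moment 1 (f t) <= moment 1 (f 0%R))%E.
Proof.
move=> t0 m0; rewrite [leLHS]moment1E.
apply: integral_le_cutoff; [exact: measurable_id|by move=> x /ltW|move=> n].
apply: le_trans (integral_cutoff_id_le _ n%:R).
apply: (integral_nonincreasing hK hf) => //.
- exact: test_function_cutoff_id.
- exact: subadditive_cutoff_id.
- exact: le_lt_trans (integral_cutoff_id_le _ _) m0.
Qed.

End mass.

(** * Gelation *)

Section gelation.
Context {R : realType} {K : R -> R -> R} {alpha : R}.
Context {f : R -> {measure set (measurableTypeR R) -> \bar R}}.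
Hypothesis hK : coagulation_kernel K.
Hypothesis hf : weak_solution K f.
Hypothesis alpha1 : 1 < alpha.
Hypothesis K_ge : forall x y : R, 0 < x -> 0 < y ->
  (x + y) * (ln (expR 1 + Num.min x y)) `^ alpha <= K x y.
Local Notation pos := (pos_half_line R).
Local Notation entropy := (@entropy R alpha).
Local Notation dissipation := (dissipation (K := K) (f := f)).

Let K_ge0 (x y : R) : 0 < x -> 0 < y -> 0 <= K x y.
Proof. by case: hK => _ + _; exact. Qed.

(** The powers of the logarithm in the kernel and in [Delta_entropy] cancel, and
    [min x y * (x + y) >= min x y * max x y]. *)
Lemma entropy_production (x y : R) : 0 < x -> 0 < y ->
  x * y <= - (Delta entropy x y * K x y).
Proof.
move=> x0 y0; have := Delta_entropy alpha1 _ _ x0 y0; have := K_ge _ _ x0 y0.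
rewrite -/(log_e _).
set z := Num.min x y; set D := Delta _ _ _ => Kz Dz.
have z0 : 0 < z by rewrite lt_min x0.
have L0 : 0 < log_e z by have := log_e_ge1 z (ltW z0); lra.
have P0 : 0 < log_e z `^ alpha by rewrite powR_gt0.
have PN : log_e z `^ (- alpha) * log_e z `^ alpha = 1.
  by rewrite powRN mulVf// gt_eqF.
have xyz : x * y <= z * (x + y).
  rewrite /z; have /orP[xy|yx] := le_total x y.
    by rewrite min_l// mulrDr lerDr mulr_ge0 ?ltW.
  by rewrite min_r// mulrDr [y * x]mulrC lerDl mulr_ge0 ?ltW.
apply: (le_trans xyz).
have -> : z * (x + y) =
    z * log_e z `^ (- alpha) * ((x + y) * log_e z `^ alpha).
  transitivity (z * (x + y) * (log_e z `^ (- alpha) * log_e z `^ alpha)).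
    by rewrite PN mulr1.
  by ring.
rewrite -mulNr; apply: ler_pM => //.
- by rewrite mulr_ge0 ?powR_ge0// ltW.
- by rewrite mulr_ge0 ?powR_ge0//; lra.
- lra.
Qed.

Lemma subadditive_entropy_cutoff (N : R) : subadditive_pos (cutoff N entropy).
Proof.
move=> x y x0 y0; have [xyN|xyN] := leP (x + y) N.
  rewrite Delta_cutoff//; apply: le_trans (Delta_entropy alpha1 _ _ x0 y0) _.
  by rewrite oppr_le0 mulr_ge0 ?powR_ge0// le_min !ltW.
by apply: Delta_cutoff_le0 => // z; exact: entropy_ge0.
Qed.

(** The entropy is cut at twice the level of the masses, so that merging two masses
    below [N] is not affected by the cut. *)
Lemma entropy_cutoff_production (N x y : R) : 0 < x -> 0 < y ->
  cutoff N id x * cutoff N id y <= - (Delta (cutoff (N + N) entropy) x y * K x y).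
Proof.
move=> x0 y0.
have loss0 : 0 <= - (Delta (cutoff (N + N) entropy) x y * K x y).
  by rewrite oppr_ge0 mulr_le0_ge0 ?K_ge0//; exact: subadditive_entropy_cutoff.
rewrite {1 2}/cutoff; case: ifP => [xN|_]; last by rewrite mul0r.
case: ifP => [yN|_]; last by rewrite mulr0.
by rewrite Delta_cutoff ?lerD//; exact: entropy_production.
Qed.

Lemma test_function_entropy_cutoff (N : R) : test_function (cutoff N entropy).
Proof.
apply: test_function_cutoff.
- exact: measurable_entropy.
- exact: entropy_ge0.
- exists (4 + tail_const (alpha := alpha) * N) => x x0 xN.
  apply: le_trans (entropy_le_bounded alpha1 _ x0) _.
  by rewrite lerD2l ler_pM2l// tail_const_gt0.
Qed.

(** The dissipation up to time [t] is at least the time integral of the squared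
    truncated mass, whose value at earlier times is at least [g]. *)
Lemma truncated_mass_bound (C t N g : R) : 0 <= t ->
  (moment 1 (f 0%R) < +oo)%E ->
  (\int[f 0%R]_(x in pos) (entropy x)%:E <= C%:E)%E ->
  (\int[f t]_(x in pos) (cutoff N id x)%:E = g%:E)%E ->
  t * g ^+ 2 <= 2 * C.
Proof.
move=> t0 m0 hC hg.
have g0 : 0 <= g.
  rewrite -lee_fin -hg; apply: integral_ge0 => x /pos_half_lineP x0.
  by rewrite lee_fin; apply: cutoff_ge0 => // z /ltW.
have hC' : (\int[f 0%R]_(x in pos) (cutoff (N + N) entropy x)%:E <= C%:E)%E.
  apply: le_trans hC; apply: le_integral_pos.
    by apply: cutoff_ge0 => x; exact: entropy_ge0.
  by apply: cutoff_le => x; exact: entropy_ge0.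
have J_le : (2^-1%:E * dissipation (cutoff (N + N) entropy) t <= C%:E)%E.
  apply: (le_trans _ hC'); rewrite -(balance hK hf _ t)//.
  - rewrite leeDr//; apply: integral_ge0 => x /pos_half_lineP x0.
    by rewrite lee_fin; apply: cutoff_ge0 => // z; exact: entropy_ge0.
  - exact: test_function_entropy_cutoff.
  - exact: subadditive_entropy_cutoff.
  - exact: le_lt_trans hC' (ltry _).
have J_ge : ((t * g ^+ 2)%:E <= dissipation (cutoff (N + N) entropy) t)%E.
  rewrite -(integral_itv_cst _ _ t0).
  apply: ge0_le_lower_integral => s; first by rewrite lee_fin sqr_ge0.
  rewrite /= in_itv/= => /andP[s0 st].
  set gs := (\int[f s]_(x in pos) (cutoff N id x)%:E)%E.
  have g_gs : (g%:E <= gs)%E.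
    rewrite -hg; apply: (integral_nonincreasing hK hf) => //.
    - exact: test_function_cutoff_id.
    - exact: subadditive_cutoff_id.
    - exact: le_lt_trans (integral_cutoff_id_le _ _) m0.
  have gs_fin : gs \is a fin_num.
    rewrite ge0_fin_numE; last by apply: le_trans g_gs; rewrite lee_fin.
    apply: le_lt_trans (integral_cutoff_id_le _ _) _.
    exact: le_lt_trans (mass_nonincreasing hK hf s s0 m0) m0.
  apply: (@le_trans _ _ (fine gs ^+ 2)%:E).
    have ggs : g <= fine gs by rewrite -lee_fin fineK.
    by rewrite lee_fin lerXn2r ?nnegrE// (le_trans g0).
  apply: (@pair_integral_ge _ _ _ (cutoff N id)).
  - by apply: measurable_cutoff; exact: measurable_id.
  - by apply: cutoff_ge0 => x /ltW.
  - exact: entropy_cutoff_production.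
  - by rewrite fineK.
have : (2^-1%:E * (t * g ^+ 2)%:E <= C%:E)%E.
  by apply: le_trans J_le; rewrite lee_wpmul2l.
by rewrite -EFinM lee_fin; lra.
Qed.

Lemma integral_entropy_lty :
  (moment 1 (f 0%R) < +oo)%E ->
  (\int[f 0%R]_(x in `]0%R, 1%R])
        (x * `|ln x| * \1_[set z : R | z < 1] x)%R%:E < +oo)%E ->
  exists C : R, (\int[f 0%R]_(x in pos) (entropy x)%:E <= C%:E)%E.
Proof.
move=> m0 q0.
set q := fun x : R => x * `|ln x| * \1_[set z : R | z < 1] x.
have q_ge0 (x : R) : 0 < x -> 0 <= q x.
  by move=> x0; rewrite /q indicE !mulr_ge0// ltW.
have mq : measurable_fun pos q.
  apply: measurable_funTS; apply: measurable_funM.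
    apply: measurable_funM => //.
    by apply: measurableT_comp => //; exact: measurable_ln.
  apply: measurable_indic.
  rewrite (_ : [set z | _] = `]-oo, 1[%classic); first exact: measurable_itv.
  by apply/seteqP; split => z /=; rewrite in_itv.
have qE : (\int[f 0%R]_(x in pos) (q x)%:E =
    \int[f 0%R]_(x in `]0%R, 1%R]) (q x)%:E)%E.
  rewrite (_ : `]0%R, 1%R]%classic = pos `&` `]0%R, 1%R]%classic).
    rewrite integral_mkcondr; apply: eq_integral => x /set_mem/pos_half_lineP x0.
    rewrite /patch; case: ifPn => //; rewrite notin_setE/= in_itv/= x0/= => /negP.
    rewrite -ltNge => x1; rewrite /q indicE memNset/= ?mulr0//.
    by move=> /(lt_trans x1); rewrite ltxx.
  rewrite setIidr// => x /=; rewrite in_itv/= => /andP[x0 _].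
  exact/pos_half_lineP.
have q_fin : (\int[f 0%R]_(x in pos) (q x)%:E)%E \is a fin_num.
  by rewrite ge0_fin_numE ?qE//; apply: integral_ge0 => x /andP[x0 _];
     rewrite lee_fin q_ge0.
have m_fin : moment 1 (f 0%R) \is a fin_num.
  rewrite ge0_fin_numE// moment1E; apply: integral_ge0 => x /pos_half_lineP x0.
  by rewrite lee_fin ltW.
exists (4 * fine (\int[f 0%R]_(x in pos) (q x)%:E)%E +
  (4 + tail_const (alpha := alpha)) * fine (moment 1 (f 0%R))).
have c0 := tail_const_gt0 alpha1.
apply: le_trans (integral_lincomb_le _ _ (4 + tail_const (alpha := alpha))
  _ _ q id _ _ _ _ _ _ _ _).
- apply: le_integral_pos => x x0; first exact: entropy_ge0.
  exact: entropy_le.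
- by [].
- lra.
- exact: mq.
- exact: measurable_id.
- exact: q_ge0.
- by move=> x /ltW.
- by rewrite fineK.
- by rewrite fineK// moment1E.
Qed.

Lemma gelling_of_log_power :
  (0 < moment 1%R (f 0%R) < +oo)%E ->
  (\int[f 0%R]_(x in `]0%R, 1%R])
        (x * `|ln x| * \1_[set z : R | z < 1] x)%R%:E < +oo)%E ->
  gelling f.
Proof.
move=> /andP[m_gt0 m_lty] q_lty.
have [C hC] := integral_entropy_lty m_lty q_lty.
have C0 : 0 <= C.
  rewrite -lee_fin; apply: le_trans hC; apply: integral_ge0 => x /pos_half_lineP x0.
  by rewrite lee_fin entropy_ge0.
have m_fin : moment 1 (f 0%R) \is a fin_num by rewrite ge0_fin_numE// ltW.
move: (m_gt0); rewrite -(fineK m_fin) lte_fin => m0.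
set m := fine _ in m0 *.
(* At this time a mass above m / 2 would exceed the bound 2 C. *)
pose t := 8 * (C + 1) / m ^+ 2.
have t0 : 0 < t by rewrite divr_gt0 ?exprn_gt0//; lra.
have tm : t * m ^+ 2 = 8 * (C + 1) by rewrite mulfVK// gt_eqF// exprn_gt0.
have half : (moment 1 (f t) <= (m / 2)%:E)%E.
  rewrite moment1E; apply: integral_le_cutoff.
  - exact: measurable_id.
  - by move=> x /ltW.
  move=> n.
  have X_ge0 : (0 <= \int[f t]_(x in pos) (cutoff n%:R id x)%:E)%E.
    apply: integral_ge0 => x /pos_half_lineP x0.
    by rewrite lee_fin; apply: cutoff_ge0 => // z /ltW.
  have X_fin : (\int[f t]_(x in pos) (cutoff n%:R id x)%:E)%E \is a fin_num.
    rewrite ge0_fin_numE//; apply: le_lt_trans (integral_cutoff_id_le _ _) _.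
    exact: le_lt_trans (mass_nonincreasing hK hf t (ltW t0) m_lty) m_lty.
  have tg := truncated_mass_bound _ _ _ _ (ltW t0) m_lty hC (esym (fineK X_fin)).
  rewrite -[leLHS](fineK X_fin) lee_fin.
  move: (fine _) tg => g tg; rewrite leNgt; apply/negP => mg.
  have : t * (m / 2) ^+ 2 < t * g ^+ 2.
    by rewrite ltr_pM2l// ltrXn2r ?nnegrE//; lra.
  have -> : t * (m / 2) ^+ 2 = t * m ^+ 2 / 4 by field.
  rewrite tm; lra.
rewrite /gelling /gelation_time.
apply: (@le_lt_trans _ _ t%:E); last exact: ltry.
apply: ereal_inf_lbound; exists t => //; split; first exact: ltW.
apply: le_lt_trans half _.
by rewrite -(fineK m_fin) lte_fin -/m; lra.
Qed.

End gelation.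

(** * Propagation of the second moment *)

(** Turns a sequence of a priori estimates, each of which halves the error of the
    previous one, into a bound without error. *)
Lemma le_of_halving {R : realType} (x y a : R) :
  (forall k, x <= y + a / 2 ^+ k) -> x <= y.
Proof.
move=> xya; apply/ler_addgt0Pr => e e0.
pose k := Num.truncn (`|a| / e).
have ak : `|a| / e < 2 ^+ k.+1.
  apply: (@lt_le_trans _ _ k.+1%:R).
    exact: truncnS_gt.
  by rewrite -natrX ler_nat ltnW// ltn_expl.
apply: le_trans (xya k.+1) _; rewrite lerD2l.
rewrite ler_pdivrMr ?exprn_gt0// (le_trans (ler_norm a))//.
by move: ak; rewrite ltr_pdivrMr// mulrC => /ltW.
Qed.

Section non_gelation.
Context {R : realType} {K : R -> R -> R}.
Context {f : R -> {measure set (measurableTypeR R) -> \bar R}} {m : R}.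
Hypothesis hK : coagulation_kernel K.
Hypothesis hf : weak_solution K f.
Hypothesis K_le : forall x y : R, 0 < x -> 0 < y ->
  K x y <= (x + y) * ln (expR 1 + Num.min x y).
Hypothesis m1 : 1 <= m.
Hypothesis M1_le : (moment 1 (f 0%R) <= m%:E)%E.
Hypothesis M2_le : (moment 2 (f 0%R) <= m%:E)%E.
Local Notation pos := (pos_half_line R).
Local Notation sq := (fun x : R => x ^+ 2).

Let K_ge0 (x y : R) : 0 < x -> 0 < y -> 0 <= K x y.
Proof. by case: hK => _ + _; exact. Qed.

Let m_gt0 : 0 < m.
Proof. exact: lt_le_trans ltr01 m1. Qed.

Lemma mass_le s : 0 <= s -> (\int[f s]_(x in pos) x%:E <= m%:E)%E.
Proof.
move=> s0; rewrite -moment1E; apply: le_trans M1_le.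
by apply: (mass_nonincreasing hK hf) => //; exact: le_lt_trans M1_le (ltry _).
Qed.

(** If [x + y > N] the left-hand side is nonpositive; otherwise it is
    [2 x y K x y], in which the term [x ^ 2 y] of [x y (x + y)] gets the tangent
    line in [y] and the term [x y ^ 2] the one in [x]. *)
Lemma Delta_square_cutoff_le (N c x y : R) : 1 <= c -> 0 < x -> 0 < y ->
  Delta (cutoff N sq) x y * K x y <=
  cutoff N sq x * (2 * c * cutoff N id y + 2 * expR (- c) * cutoff N sq y) +
  (2 * c * cutoff N id x + 2 * expR (- c) * cutoff N sq x) * cutoff N sq y.
Proof.
move=> c1 x0 y0; have e0 := expR_gt0 (- c).
have q0 z : 0 < z -> 0 <= cutoff N sq z.
  by move=> z0; apply: cutoff_ge0 => // w _; exact: sqr_ge0.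
have p0 z : 0 < z -> 0 <= cutoff N id z.
  by move=> z0; apply: cutoff_ge0 => // w /ltW.
have [xyN|xyN] := leP (x + y) N; last first.
  apply: (@le_trans _ _ 0).
    apply: mulr_le0_ge0; last exact: K_ge0.
    by apply: Delta_cutoff_le0 => // z _; exact: sqr_ge0.
  have c0 : 0 <= c by lra.
  by rewrite addr_ge0// mulr_ge0 ?q0// addr_ge0// !mulr_ge0 ?q0 ?p0// ltW.
have xN : x <= N by lra.
have yN : y <= N by lra.
rewrite Delta_cutoff// /cutoff xN yN.
have -> : Delta sq x y = 2 * (x * y) by rewrite /Delta; ring.
have z0 : 0 <= Num.min x y by rewrite le_min !ltW.
have zx : Num.min x y <= x by rewrite ge_min lexx.
have zy : Num.min x y <= y by rewrite ge_min lexx orbT.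
set l := log_e (Num.min x y).
have lx : l <= c + x * expR (- c).
  apply: le_trans (log_e_le_tangent _ _ c1 (ltW x0)).
  exact: le_log_e.
have ly : l <= c + y * expR (- c).
  apply: le_trans (log_e_le_tangent _ _ c1 (ltW y0)).
  exact: le_log_e.
apply: (@le_trans _ _ (2 * (x * y) * ((x + y) * l))).
  by rewrite ler_pM2l ?K_le// !mulr_gt0.
have hx : x * y ^+ 2 * l <= x * y ^+ 2 * (c + x * expR (- c)).
  by rewrite ler_pM2l// mulr_gt0// exprn_gt0.
have hy : x ^+ 2 * y * l <= x ^+ 2 * y * (c + y * expR (- c)).
  by rewrite ler_pM2l// mulr_gt0// exprn_gt0.
rewrite /=; lra.
Qed.

Lemma measurable_sq : measurable_fun pos sq.
Proof. exact: exprn_measurable. Qed.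

Lemma square_cutoff_ge0 (N x : R) : 0 <= cutoff N sq x.
Proof. by rewrite /cutoff; case: ifP => // _; exact: sqr_ge0. Qed.

Lemma pair_integral_square_le (N c s u : R) : 1 <= c -> 0 <= s ->
  (\int[f s]_(x in pos) (cutoff N sq x)%:E <= u%:E)%E ->
  (pair_integral (f s) (fun x y => Delta (cutoff N sq) x y * K x y)%R <=
   (2 * u * (2 * c * m + 2 * expR (- c) * u))%:E)%E.
Proof.
move=> c1 s0 uq; have e0 := expR_gt0 (- c).
have c0 : 0 <= c by lra.
have mq : measurable_fun pos (cutoff N sq).
  by apply: measurable_cutoff; exact: measurable_sq.
have mp : measurable_fun pos (cutoff N id).
  by apply: measurable_cutoff; exact: measurable_id.
have q0 z : 0 < z -> 0 <= cutoff N sq z by move=> _; exact: square_cutoff_ge0.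
have p0 z : 0 < z -> 0 <= cutoff N id z.
  by move=> z0; apply: cutoff_ge0 => // w /ltW.
apply: (@pair_integral_le _ _ _ (cutoff N sq)
  (fun x => 2 * c * cutoff N id x + 2 * expR (- c) * cutoff N sq x)) => //.
- by apply: measurable_funD; apply: measurable_funM.
- by move=> x x0; rewrite addr_ge0// !mulr_ge0 ?q0 ?p0// ltW.
- by move=> x y x0 y0; exact: Delta_square_cutoff_le.
- apply: integral_lincomb_le => //; first by rewrite mulr_ge0.
  apply: le_trans (integral_cutoff_id_le _ _) _.
  by rewrite moment1E; exact: mass_le.
Qed.

(** [barrier] is the solution of [w' = 4 m c w] with [c = growth_rate],
    and is such that [exp (- c) * w = m]: the quadratic term [exp (- c) * w ^ 2]
    of the tangent line bound is then only linear. *)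
Definition growth_rate (s : R) : R := expR (4 * m * s).

Definition barrier (s : R) : R := m * expR (growth_rate s).

(** The function [E |-> m exp E] absorbs the quadratic term: [exp (- E) * u ^ 2] is
    bounded by [m * u] up to the excess [z] of [u] over the barrier.  The a
    priori bound [B] makes the remainder linear in [z]. *)
Lemma barrier_inequality (E B u z Emax : R) : 1 <= E -> E <= Emax ->
  0 <= u -> u <= B -> 0 <= z -> u <= m * expR E + z ->
  2 * u * (2 * E * m + 2 * expR (- E) * u) <=
  2 * (4 * m * E * (m * expR E) + 2 * (m * Emax + m + B) * z).
Proof.
move=> E1 EEmax u0 uB z0 uwz; have m0 := m_gt0.
set w := m * expR E in uwz *.
have w0 : 0 < w by rewrite mulr_gt0// expR_gt0.
have a0 : 0 < expR (- E) := expR_gt0 _.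
have a1 : expR (- E) <= 1 by rewrite expR_le1; lra.
have aw : expR (- E) * w = m.
  by rewrite /w mulrCA -expRD addrC subrr expR0 mulr1.
have h1 : m * E * u <= m * E * (w + z) by rewrite ler_pM2l// mulr_gt0//; lra.
have h2 : m * z * E <= m * z * Emax by rewrite ler_wpM2l// mulr_ge0// ltW.
have h3 : expR (- E) * u * u <= expR (- E) * u * (w + z).
  by rewrite ler_wpM2l// mulr_ge0// ltW.
have h4 : expR (- E) * u * w = m * u by rewrite -aw; ring.
have h5 : expR (- E) * u * z <= 1 * B * z.
  by rewrite ler_wpM2r// ler_pM// ltW.
have h6 : m * u <= m * (w + z) by rewrite ler_pM2l.
have h7 : m * w * 1 <= m * w * E by rewrite ler_pM2l// mulr_gt0.
have h8 : expR (- E) * u * (w + z) = expR (- E) * u * w + expR (- E) * u * z.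
  by ring.
have h9 : 2 * u * (2 * E * m + 2 * expR (- E) * u) =
  4 * (m * E * u) + 4 * (expR (- E) * u * u) by ring.
rewrite h9; lra.
Qed.

Lemma is_derive_expR_lin (a s : R) :
  is_derive s 1 (fun s : R => expR (a * s)) (a * expR (a * s)).
Proof.
have h : is_derive s 1 ( *%R a) a.
  have := @is_deriveZ _ _ _ id a s 1 1 (is_derive_id _ _).
  by rewrite [a *: 1]mulr1; exact.
rewrite mulrC; exact: is_derive1_comp.
Qed.

Lemma is_derive_barrier (s : R) :
  is_derive s 1 barrier (4 * m * growth_rate s * barrier s).
Proof.
have hE := is_derive_expR_lin (4 * m) s.
have := @is_derive1_comp _ expR growth_rate s _ _ (is_derive_expR _) hE.
move=> /(@is_deriveZ _ _ _ _ m s 1 _).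
rewrite [_ *: _](_ : _ = 4 * m * growth_rate s * barrier s); first exact.
by rewrite /barrier /growth_rate /GRing.scale/=; ring.
Qed.

Lemma growth_rate_ge1 (s : R) : 0 <= s -> 1 <= growth_rate s.
Proof.
by move=> s0; rewrite -[leLHS]expR0 ler_expR !mulr_ge0// (ltW m_gt0).
Qed.

Lemma le_growth_rate (s t : R) : s <= t -> growth_rate s <= growth_rate t.
Proof. by move=> st; rewrite ler_expR ler_pM2l// mulr_gt0// m_gt0. Qed.

Lemma le_barrier (s t : R) : s <= t -> barrier s <= barrier t.
Proof.
by move=> st; rewrite ler_pM2l ?m_gt0// ler_expR le_growth_rate.
Qed.


Section truncated_second_moment.
Variables (n : nat) (T : R).
Hypothesis T0 : 0 <= T.
Local Notation N := (n%:R : R).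
Local Notation q := (cutoff N sq).

Definition truncated_moment (s : R) : \bar R := (\int[f s]_(x in pos) (q x)%:E)%E.

Let Q_ge0 s : (0 <= truncated_moment s)%E.
Proof. by apply: integral_ge0 => x _; rewrite lee_fin square_cutoff_ge0. Qed.

Let Q_le s : 0 <= s -> (truncated_moment s <= (N * m)%:E)%E.
Proof.
move=> s0.
have -> : N * m = N * m + 0 * m by rewrite mul0r addr0.
apply: le_trans (integral_lincomb_le (f s) N 0 m m id id _ _ _ _ _ _ _ _) => //.
- apply: le_integral_pos => x x0; first exact: square_cutoff_ge0.
  rewrite mul0r addr0 /cutoff; case: ifP => xN.
    by rewrite expr2 ler_pM2r.
  by rewrite mulr_ge0// ltW.
- by move=> x /ltW.
- by move=> x /ltW.
- exact: mass_le.
- exact: mass_le.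
Qed.

(** Twice the factor with which the excess over the barrier enters the differential
    inequality of the truncated moment on [[0, T]]. *)
Definition lag_rate : R := 4 * (m * growth_rate T + m + N * m).

(** Uniqueness argument of Cauchy-Lipschitz type: in the norm weighted by
    [exp (lag_rate * s)], integrating the inequality contracts by one half the
    excess over the barrier. *)
Lemma truncated_moment_halve (c : R) : 0 <= c ->
  (forall s, 0 <= s -> s <= T ->
    (truncated_moment s <= (barrier s + c * expR (lag_rate * s))%:E)%E) ->
  forall s, 0 <= s -> s <= T ->
    (truncated_moment s <= (barrier s + c / 2 * expR (lag_rate * s))%:E)%E.
Proof.
move=> c0 IH t t0 tT.
have m0 := m_gt0.
have tq : test_function q.
  apply: test_function_cutoff; [exact: measurable_sq|by move=> x _; exact: sqr_ge0|].
  exists (N ^+ 2) => x x0 xN.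
  by rewrite lerXn2r ?nnegrE// ltW.
case: hf => _ _ /(_ q); case: tq => mq q0 qC /(_ mq q0 qC t t0).
rewrite -/(truncated_moment t) -/(truncated_moment 0) => ->.
pose H (s : R) := 2 * (barrier s + c / 2 * expR (lag_rate * s)).
pose h (s : R) := 2 * (4 * m * growth_rate s * barrier s +
  2 * (m * growth_rate T + m + N * m) * (c * expR (lag_rate * s))).
have dH (s : R) : is_derive s 1 H (h s).
  have dE := @is_deriveZ _ _ _ _ (c / 2) s 1 _ (is_derive_expR_lin lag_rate s).
  have dB := is_derive_barrier s.
  have := @is_deriveZ _ _ _ _ 2 s 1 _ (@is_deriveD _ _ _ _ _ s 1 _ _ dB dE).
  rewrite [_ *: _](_ : _ = h s); first exact.
  by rewrite /h /lag_rate /GRing.scale/=; field.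
have ch : continuous h.
  have cH a : continuous (fun s : R => expR (a * s)).
    move=> s; apply: differentiable_continuous; apply/derivable1_diffP.
    exact: (@ex_derive _ _ _ _ _ _ _ (is_derive_expR_lin a s)).
  have cB : continuous barrier.
    move=> s; apply: differentiable_continuous; apply/derivable1_diffP.
    exact: (@ex_derive _ _ _ _ _ _ _ (is_derive_barrier s)).
  move=> s; apply: cvgM; first exact: cvg_cst.
  apply: cvgD; apply: cvgM; [|exact: cB|exact: cvg_cst|].
    by apply: cvgM; [exact: cvg_cst|exact: cH].
  by apply: cvgM; [exact: cvg_cst|exact: cH].
have inth := integral_itv_derive H h t t0 dH ch.
have step : (\int[@lebesgue_measure R]_(s in `[0%R, t])
    pair_integral (f s) (fun x y => Delta q x y * K x y)%R <= (H t - H 0)%:E)%E.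
  rewrite -inth; apply: le_lower_integral => s; rewrite /= in_itv/= => /andP[s0 st].
    rewrite lee_fin /h; have g0 := growth_rate_ge1 s s0.
    have gT := growth_rate_ge1 T T0.
    by rewrite mulr_ge0// addr_ge0// !mulr_ge0// ?addr_ge0// ?mulr_ge0 ?expR_ge0//; lra.
  have Qfin : truncated_moment s \is a fin_num.
    by rewrite ge0_fin_numE//; apply: le_lt_trans (Q_le s s0) (ltry _).
  apply: le_trans (pair_integral_square_le N (growth_rate s) s
    (fine (truncated_moment s)) _ s0 _) _.
  - exact: growth_rate_ge1.
  - by rewrite fineK.
  rewrite lee_fin; apply: barrier_inequality.
  - exact: growth_rate_ge1.
  - by rewrite le_growth_rate// (le_trans st).
  - by rewrite fine_ge0.
  - by rewrite -lee_fin fineK// Q_le.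
  - by rewrite mulr_ge0 ?expR_ge0.
  - by rewrite -lee_fin fineK// IH// (le_trans st).
have Q0 : (truncated_moment 0 <= m%:E)%E.
  apply: le_trans M2_le; rewrite (moment_exprn _ 2).
  apply: le_integral_pos => x x0; first exact: square_cutoff_ge0.
  by apply: cutoff_le => // w _; exact: sqr_ge0.
apply: (@le_trans _ _ (m%:E + 2^-1%:E * (H t - H 0)%:E)%E).
  by apply: leeD => //; rewrite lee_wpmul2l.
rewrite -EFinM -EFinD lee_fin /H /barrier /growth_rate !mulr0 expR0.
have me : m * 1 <= m * expR 1 by rewrite ler_pM2l// -[leLHS]expR0 ler_expR.
lra.
Qed.

(** The iteration starts from the crude bound [N * m], and the resulting bound does
    not depend on the level of the cut-off. *)
Lemma truncated_moment_le_barrier s : 0 <= s -> s <= T ->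
  (truncated_moment s <= (barrier s)%:E)%E.
Proof.
move=> s0 sT.
have Nm0 : 0 <= N * m by rewrite mulr_ge0// ltW ?m_gt0.
have IH k : forall r, 0 <= r -> r <= T ->
    (truncated_moment r <= (barrier r + N * m / 2 ^+ k * expR (lag_rate * r))%:E)%E.
  elim: k => [r r0 rT|k IH r r0 rT].
    apply: le_trans (Q_le r r0) _.
    rewrite lee_fin expr0 divr1 ler_wpDl//.
      by rewrite mulr_ge0 ?expR_ge0// ltW// m_gt0.
    rewrite ler_peMr// -[leLHS]expR0 ler_expR.
    have gT := growth_rate_ge1 T T0; have m0 := m_gt0.
    by rewrite /lag_rate !mulr_ge0// !addr_ge0// ?mulr_ge0//; lra.
  have := truncated_moment_halve _ _ IH r r0 rT.
  rewrite exprSr invfM mulrA; apply.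
  by rewrite divr_ge0// exprn_ge0.
have Qfin : truncated_moment s \is a fin_num.
  by rewrite ge0_fin_numE//; apply: le_lt_trans (Q_le s s0) (ltry _).
rewrite -(fineK Qfin) lee_fin.
apply: (@le_of_halving _ _ _ (N * m * expR (lag_rate * s))).
by move=> k; rewrite mulrAC -lee_fin fineK// IH.
Qed.

End truncated_second_moment.

Lemma second_moment_le s : 0 <= s ->
  (\int[f s]_(x in pos) (x ^+ 2)%:E <= (barrier s)%:E)%E.
Proof.
move=> s0; apply: integral_le_cutoff; [exact: measurable_sq| |].
  by move=> x _; exact: sqr_ge0.
by move=> n; exact: (truncated_moment_le_barrier n s s0 s s0 (lexx s)).
Qed.

(** * Conservation of mass *)

Local Notation trunc N := (fun x : R => Num.min x N).

Lemma Delta_trunc_le0 (N : R) : 0 <= N -> subadditive_pos (trunc N).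
Proof.
move=> N0 x y x0 y0; rewrite /Delta.
by have [?|?] := leP (x + y) N; have [?|?] := leP x N; have [?|?] := leP y N; lra.
Qed.

Lemma test_function_trunc (N : R) : 0 <= N -> test_function (trunc N).
Proof.
move=> N0; split.
- by apply: measurable_minr; [exact: measurable_id|exact: measurable_cst].
- by move=> x x0; rewrite le_min ltW.
- by exists N => x _; rewrite ge_min lexx orbT.
Qed.

(** If [y <= x], the loss is at most [y] and vanishes unless [2 x > N]; a factor
    [2 x / N >= 1] is then inserted. *)
Lemma trunc_loss_le (N k x y : R) : 0 < N -> 0 < x -> 0 < y -> 0 <= k ->
  k <= (x + y) * log_e (Num.min x y) ->
  - (Delta (trunc N) x y * k) <=
  x ^+ 2 * (4 / N * (y + y ^+ 2)) + 4 / N * (x + x ^+ 2) * y ^+ 2.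
Proof.
move=> N0; wlog yx : x y / y <= x => [H x0 y0 k0|x0 y0 k0].
  have /orP[yx|xy] := le_total y x; first exact: H.
  rewrite DeltaC minC [x + y]addrC => kle.
  have := H y x xy y0 x0 k0 kle; lra.
rewrite min_r// => kle.
have c0 : 0 <= 4 / N by rewrite divr_ge0// ltW.
have x2 : 0 <= x ^+ 2 := sqr_ge0 x.
have y2 : 0 <= y ^+ 2 := sqr_ge0 y.
have r0 : 0 <= 4 / N * (x + x ^+ 2) * y ^+ 2.
  by rewrite (mulr_ge0 (mulr_ge0 c0 (addr_ge0 (ltW x0) x2))).
have s0 : 0 <= x ^+ 2 * (4 / N * (y + y ^+ 2)).
  by rewrite (mulr_ge0 x2 (mulr_ge0 c0 (addr_ge0 (ltW y0) y2))).
have [xyN|xyN] := leP (x + y) N.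
  rewrite /Delta !min_l; [|lra..].
  have -> : x + y - x - y = 0 by lra.
  by rewrite mul0r oppr0 addr_ge0.
have Dy : - Delta (trunc N) x y <= y.
  have : Num.min x N <= Num.min (x + y) N.
    by rewrite le_min ge_min lerDl (ltW y0)/= ge_min lexx orbT.
  have : Num.min y N <= y by rewrite ge_min lexx.
  rewrite /Delta; lra.
have D0 : 0 <= - Delta (trunc N) x y.
  by rewrite oppr_ge0; apply: Delta_trunc_le0 => //; exact: ltW.
have ly : log_e y <= 1 + y.
  have := log_e_le_tangent 1 y (lexx 1) (ltW y0).
  have : y * expR (- 1) <= y * 1.
    by rewrite ler_pM2l// -[leRHS]expR0 ler_expR oppr_le0.
  lra.
have xN : 1 <= 2 * x / N by rewrite ler_pdivlMr//; lra.
apply: (@le_trans _ _ (x ^+ 2 * (4 / N * (y + y ^+ 2)))); last by rewrite lerDl.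
rewrite -mulNr.
apply: (@le_trans _ _ (y * (2 * x * (1 + y)))).
  apply: ler_pM => //; apply: (le_trans kle).
  apply: ler_pM => //; [lra| |lra].
  by have := log_e_ge1 y (ltW y0); lra.
have -> : x ^+ 2 * (4 / N * (y + y ^+ 2)) =
    y * (2 * x * (1 + y)) * (2 * x / N) by ring.
by rewrite ler_peMr// !mulr_ge0//; lra.
Qed.

(** The moments of order one and two are bounded on [[0, t]], hence the loss is of
    order [1 / N]. *)
Lemma trunc_mass_loss (N t : R) : 0 < N -> 0 <= t ->
  (\int[f 0%R]_(x in pos) (trunc N x)%:E <=
   moment 1 (f t) + (4 * barrier t * (m + barrier t) * t / N)%:E)%E.
Proof.
move=> N0 t0; set W := barrier t.
have m0 := m_gt0.
have W0 : 0 <= W by rewrite mulr_ge0 ?expR_ge0// ltW.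
have tpsi := test_function_trunc N (ltW N0).
have sub := Delta_trunc_le0 N (ltW N0).
have le_mass s : (\int[f s]_(x in pos) (trunc N x)%:E <= moment 1 (f s))%E.
  rewrite moment1E; apply: le_integral_pos => x x0; first by rewrite le_min !ltW.
  by rewrite ge_min lexx.
have fin0 : (\int[f 0%R]_(x in pos) (trunc N x)%:E < +oo)%E.
  exact: le_lt_trans (le_mass 0) (le_lt_trans M1_le (ltry _)).
rewrite -(balance hK hf _ t tpsi sub t0 fin0); apply: leeD; first exact: le_mass.
pose D := 2 * W * (4 / N * m + 4 / N * W).
have c0 : 0 <= 4 / N by rewrite divr_ge0// ltW.
have m_ge0 := ltW m0.
have D0 : 0 <= D.
  exact: mulr_ge0 (mulr_ge0 (ler0n _ 2) W0)
    (addr_ge0 (mulr_ge0 c0 m_ge0) (mulr_ge0 c0 W0)).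
have J_le : (dissipation (K := K) (f := f) (trunc N) t <= (t * D)%:E)%E.
  rewrite -(integral_itv_cst _ _ t0).
  apply: le_lower_integral => s; first by rewrite lee_fin.
  rewrite /= in_itv/= => /andP[s0 st].
  have sW : (\int[f s]_(x in pos) (x ^+ 2)%:E <= W%:E)%E.
    by apply: le_trans (second_moment_le s s0) _; rewrite lee_fin le_barrier.
  apply: (@pair_integral_le _ _ _ sq (fun x => 4 / N * x + 4 / N * x ^+ 2)) => //.
  - apply: measurable_funD; apply: measurable_funM; [exact: measurable_cst| |
      exact: measurable_cst|exact: measurable_sq].
    exact: measurable_id.
  - by move=> x _; exact: sqr_ge0.
  - by move=> x x0; rewrite addr_ge0// mulr_ge0// ?sqr_ge0// ltW.
  - move=> x y x0 y0; rewrite -!mulrDr.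
    by apply: trunc_loss_le => //; [exact: K_ge0|exact: K_le].
  - apply: integral_lincomb_le => //.
    + by move=> x /ltW.
    + by move=> x _; exact: sqr_ge0.
    + exact: mass_le.
apply: (@le_trans _ _ (2^-1%:E * (t * D)%:E)%E); first by rewrite lee_wpmul2l.
rewrite -EFinM lee_fin /D le_eqVlt; apply/orP; left; apply/eqP.
by field; rewrite gt_eqF.
Qed.

Lemma mass_conserved t : 0 <= t -> moment 1 (f t) = moment 1 (f 0%R).
Proof.
move=> t0; apply/eqP; rewrite eq_le; apply/andP; split.
  by apply: (mass_nonincreasing hK hf) => //; exact: le_lt_trans M1_le (ltry _).
rewrite [leLHS]moment1E.
apply: integral_le_cutoff; [exact: measurable_id|by move=> x /ltW|move=> n].
apply/lee_addgt0Pr => e e0.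
set C := 4 * barrier t * (m + barrier t) * t.
pose N : R := Num.max n%:R (Num.max 1 (C / e)).
have N0 : 0 < N by rewrite !lt_max ltr01 orbT.
apply: (@le_trans _ _ (\int[f 0%R]_(x in pos) (trunc N x)%:E)%E).
  apply: le_integral_pos => x x0; first by apply: cutoff_ge0 => // z /ltW.
  rewrite /cutoff; case: ifP => xn; last by rewrite le_min !ltW.
  by rewrite le_min lexx !le_max xn.
apply: le_trans (trunc_mass_loss N t N0 t0) _.
rewrite leeD2l// lee_fin ler_pdivrMr// -/C mulrC -ler_pdivrMr//.
by rewrite !le_max lexx !orbT.
Qed.

End non_gelation.

(** * The criterion *)

Theorem proposition7 (R : realType) (K : R -> R -> R)
    (hK : coagulation_kernel K) :
  ((forall x y : R, 0 < x -> 0 < y ->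
      K x y <= (x + y) * ln (expR 1 + Num.min x y)) ->
   forall f : R -> {measure set (measurableTypeR R) -> \bar R},
     weak_solution K f ->
     (moment 1%R (f 0%R) + moment 2%R (f 0%R) < +oo)%E ->
     non_gelling f)
  /\
  ((exists alpha : R, 1 < alpha /\
      forall x y : R, 0 < x -> 0 < y ->
        (x + y) * (ln (expR 1 + Num.min x y)) `^ alpha <= K x y) ->
   forall f : R -> {measure set (measurableTypeR R) -> \bar R},
     weak_solution K f ->
     (0 < moment 1%R (f 0%R) < +oo)%E ->
     (\int[f 0%R]_(x in `]0%R, 1%R])
        (x * `|ln x| * \1_[set z : R | z < 1] x)%R%:E < +oo)%E ->
     gelling f).
Proof.
split.
  move=> K_le f hf M_lty.
  have M_ge0 (n : nat) : (0 <= moment n%:R (f 0%R))%E.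
    apply: integral_ge0 => x _; rewrite lee_fin; exact: powR_ge0.
  have M_fin : (moment 1 (f 0%R) + moment 2 (f 0%R))%E \is a fin_num.
    by rewrite ge0_fin_numE// adde_ge0// (M_ge0 1, M_ge0 2).
  pose m := 1 + fine (moment 1 (f 0%R) + moment 2 (f 0%R))%E.
  have mE : (m%:E = 1 + (moment 1 (f 0%R) + moment 2 (f 0%R)))%E.
    by rewrite EFinD fineK.
  apply: (mass_conserved hK hf K_le (m := m)).
  - by rewrite lerDl fine_ge0// adde_ge0// (M_ge0 1, M_ge0 2).
  - rewrite mE addeCA leeDl// adde_ge0//; exact: (M_ge0 2).
  - rewrite mE addeA leeDr// adde_ge0//; exact: (M_ge0 1).
move=> [alpha [alpha1 K_ge]] f hf.
exact: (gelling_of_log_power hK hf alpha1 K_ge).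
Qed.
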